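(* Let $(P,x)$ be a marked finite poset. Then: (a) $\lambda_{0,0}(P,x)$ is $1$ if $x$ is an isolated point of $P$, and $0$ otherwise. (b) $\lambda_{\ast,0}(P,x)$ is $1$ if $x$ is the greatest element of $P$, and $0$ otherwise. (c) If $x$ is not a maximal element of $P$ then $\lambda_{1,0}(P,x)=0$. If $x$ is maximal, let $\epsilon$ be $1$ if $x$ covers a unique element and $0$ otherwise, and let $n$ be the number of lower twins of $x$; then $\lambda_{1,0}(P,x)=\epsilon-n$. (d) Let $\epsilon$ be $1$ if $x$ begins a series pair and $0$ otherwise. Then $\lambda_{\ast,1}(P,x)=\epsilon-\tau(P,x)$.
   Context: All posets are finite. A marked poset is a pair $(P,x)$ with $x\in P$. Write $P_{<x}$, $P_{>x}$, $P_{\parallel x}$ for the sets of elements of $P\setminus\{x\}$ below, above, incomparable to $x$. For subsets, $A<B$ means $a<b$ for all $a\in A$, $b\in B$. $\mathrm{Max}$ and $\mathrm{Min}$ denote sets of maximal and minimal elements. The element $x$ is isolated if it is incomparable to all other elements; it is greatest if all other elements are below it. An element $y$ covers $x$ if $x<y$ and there is no $a$ with $x<a<y$. A cut of $(P,x)$ is a pair $(L,R)$ of subsets of $P_{\parallel x}$ with $L\cup P_{<x}<R\cup P_{>x}$. Put $p(L)=|\mathrm{Max}(L\cup P_{<x})|$, $q(R)=|\mathrm{Min}(R\cup P_{>x})|$, and $\lambda(P,x)=\sum_{(L,R)}(-1)^{|L|+|R|}u^{p(L)}v^{q(R)}\in\mathbf{Z}[u,v]$, the sum over all cuts. $\lambda_{p,q}(P,x)$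 is the coefficient of $u^pv^q$ in $\lambda(P,x)$, and $\lambda_{\ast,q}(P,x)=\sum_{p\ge0}\lambda_{p,q}(P,x)$. For distinct $x,y\in P$: $y$ is a lower twin of $x$ if $P_{<x}=P_{<y}$; $y$ is a twin of $x$ if $P_{<x}=P_{<y}$ and $P_{>x}=P_{>y}$; $\tau(P,x)$ is the number of twins of $x$. A pair $x<y$ is a series pair if $y$ is the unique cover of $x$ and $x$ is the unique element covered by $y$ (equivalently $P_{<y}=P_{\le x}$ and $P_{>x}=P_{\ge y}$); then $x$ is said to begin the series pair. *)

(* Defs.v *)
From HB Require Import structures.
From mathcomp Require Import all_boot all_order all_algebra.

Set Implicit Arguments.
Unset Strict Implicit.
Unset Printing Implicit Defensive.

Import Order.TTheory GRing.Theory Num.Theory.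

Local Open Scope order_scope.

Section Posets.
Context {d : Order.disp_t} {P : finPOrderType d}.
Implicit Types (x y a b : P) (A B L R : {set P}).

Definition below x : {set P} := [set y | y < x].
Definition above x : {set P} := [set y | x < y].
Definition parallel x : {set P} := [set y | y >< x].

Definition set_lt A B : bool := [forall a in A, forall b in B, a < b].

Definition Max A : {set P} := [set a in A | [forall b in A, ~~ (a < b)]].
Definition Min A : {set P} := [set a in A | [forall b in A, ~~ (b < a)]].

Definition maximal x : bool := x \in Max [set: P].
Definition isolated x : bool := [forall y, (y != x) ==> (y >< x)].
Definition greatest x : bool := [forall y, (y != x) ==> (y < x)].

(* In [covers y x], y is the larger element. *)
Definition covers y x : bool := (x < y) && [forall a, ~~ (x < a < y)].
Definition upper_covers x : {set P} := [set y | covers y x].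
Definition lower_covers x : {set P} := [set y | covers x y].

Definition cut x L R : bool :=
  [&& L \subset parallel x, R \subset parallel x &
      set_lt (L :|: below x) (R :|: above x)].

Definition cut_p x L : nat := #|Max (L :|: below x)|.
Definition cut_q x R : nat := #|Min (R :|: above x)|.

(* Z[u, v] is Z[u][v]: u is the inner variable 'X%:P, v the outer one 'X. *)
Definition lambda x : {poly {poly int}} :=
  (\sum_(LR : {set P} * {set P} | cut x LR.1 LR.2)
     (-1) ^+ (#|LR.1| + #|LR.2|)
       * ('X%:P) ^+ cut_p x LR.1 * 'X ^+ cut_q x LR.2)%R.

Definition lambda_coef (p q : nat) x : int := ((lambda x)`_q)`_p.

(* The sum over all p >= 0: coefficients from the size on vanish. *)
Definition lambda_star (q : nat) x : int :=
  (\sum_(0 <= p < size (lambda x)`_q) lambda_coef p q x)%R.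

(* [lower_twin x y]: y is a lower twin of x; likewise for [twin]. *)
Definition lower_twin x y : bool := (y != x) && (below x == below y).
Definition twin x y : bool :=
  [&& y != x, below x == below y & above x == above y].

Definition lower_twin_count x : nat := #|[set y | lower_twin x y]|.
Definition tau x : nat := #|[set y | twin x y]|.

Definition series_pair x y : bool :=
  [&& x < y, upper_covers x == [set y] & lower_covers y == [set x]].
Definition begins_series_pair x : bool := [exists y, series_pair x y].

End Posets.

(* Main.v *)
Require Import Defs.
From HB Require Import structures.
From mathcomp Require Import all_boot all_order all_algebra.

Set Implicit Arguments.
Unset Strict Implicit.
Unset Printing Implicit Defensive.

Import Order.TTheory GRing.Theory Num.Theory.

Local Open Scope ring_scope.

(** Fix [x]. The conditions on a cut that select the coefficients in question
    leave most elements free to be inserted or removed, and toggling one free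
    element cancels the signs. So only the rigid configurations contribute: if
    [A] and [C] are the forced and the allowed elements, the sum of [(-1)^|L|]
    over [L] between [A] and [C] vanishes unless [A = C]
    ([signed_sum_interval]).

    When [q = 0], both [R] and [above x] are empty; hence [x] is maximal, [R] is
    empty, and [L] is an arbitrary subset of [parallel x] ([signed_sum_cut_q0]).
    Leaving [p] free, or prescribing [p = 0] or [p = 1], then leads to three of
    the four claims.

    A condition of the form [|Max S| = 1] says that [S] has a greatest element
    [m], since in a finite poset a unique maximal element is greatest; the sum
    is split according to [m] ([sum_card1]). For [S] the union of [L] and [below
    x] there are two possibilities ([signed_sum_Max]). Either [m] is already the
    greatest element of [below x], that is, [m] is the only element covered by
    [x], which forces [L] to be empty and contributes [1]; or [m] lies in [L],
    and rigidity forces [L = {m}] with [below m = below x], which contributes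
    [-1] for a lower twin. The same count in the dual poset handles [Min]
    ([signed_sum_Min]).

    When [q = 1] and [m] is the least element of the union of [R] and [above x],
    the cut condition only compares [L] and [below x] with [m], so the sum is a
    product of a sum over [L] and a sum over [R] ([signed_sum_cut_least]). The
    sum over [L] forces [below x] to lie below [m] and no element parallel to
    [x] to lie below [m]. This turns the two possibilities for [m] into: [m]
    forms a series pair with [x], or [m] is a twin of [x]. *)

(** * Signed sums over families of sets *)

Section SignedSums.
Variable T : finType.
Implicit Types (A B C D F L : {set T}) (m e : T).

Lemma setD1_id A e : e \notin A -> A :\ e = A.
Proof. by rewrite -disjoints1 disjoint_sym => /setDidPl. Qed.

Definition toggle e L : {set T} := if e \in L then L :\ e else e |: L.

Lemma toggleK e : involutive (toggle e).
Proof.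
move=> L; rewrite /toggle; case: (boolP (e \in L)) => eL.
  by rewrite !inE eqxx /= setD1K.
by rewrite !inE eqxx /= setU1K.
Qed.

Lemma sign_toggle e L : (-1) ^+ #|toggle e L| = - (-1) ^+ #|L| :> int.
Proof.
rewrite /toggle; case: (boolP (e \in L)) => eL.
  by rewrite [in RHS](cardsD1 e) eL exprS mulN1r opprK.
by rewrite cardsU1 eL exprS mulN1r.
Qed.

(** Toggling an element of [C] outside [A] is a sign-reversing involution of the
    interval, so the sum equals its own opposite. *)
Lemma signed_sum_interval A C : A \subset C ->
  \sum_(L : {set T} | (A \subset L) && (L \subset C)) (-1) ^+ #|L|
    = if A == C then (-1) ^+ #|A| else 0 :> int.
Proof.
move=> sAC; case: eqVneq => [<- | neqAC].
  by rewrite (big_pred1 A) // => L; rewrite -eqEsubset eq_sym.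
have [e eC eA] : exists2 e, e \in C & e \notin A.
  by apply/subsetPn; apply: contra neqAC => sCA; rewrite eqEsubset sAC.
set S := \sum_(L | _) _.
have SN : S = - S.
  rewrite {1}/S (reindex_inj (inv_inj (toggleK e))) /= -sumrN.
  apply: eq_big => [L | L _]; last exact: sign_toggle.
  rewrite /toggle; case: ifP => eL; congr (_ && _).
  - by rewrite subsetD1 eA andbT.
  - by rewrite subDset (setUidPr _) // sub1set.
  - by rewrite -subDset (setD1_id eA).
  - by rewrite subUset sub1set eC.
by move/eqP: SN; rewrite -addr_eq0 -mulr2n mulrn_eq0 => /eqP.
Qed.

Lemma signed_sum_subset C :
  \sum_(L : {set T} | L \subset C) (-1) ^+ #|L|
    = if C == set0 then 1 else 0 :> int.
Proof.
have := signed_sum_interval (sub0set C); rewrite eq_sym cards0 => <-.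
by apply: eq_bigl => L; rewrite sub0set.
Qed.

Lemma signed_sum_pairs (Q1 Q2 : pred {set T}) :
  \sum_(LR : {set T} * {set T} | Q1 LR.1 && Q2 LR.2)
     (-1) ^+ (#|LR.1| + #|LR.2|)
    = (\sum_(L | Q1 L) (-1) ^+ #|L|) * (\sum_(R | Q2 R) (-1) ^+ #|R|) :> int.
Proof.
rewrite big_distrlr /= pair_big.
by apply: eq_bigr => LR _; rewrite exprD.
Qed.

(** Order-free core of the count by greatest elements: [D] stands for the set
    below [m], so the condition on [L] says that [m] is the greatest element of
    the union of [L] and [B].  Whenever this is possible, [L] ranges over the
    interval from [F :&: [set m]] to the union of that set and [F :&: D]. *)
Lemma signed_sum_apex B D F m : m \notin D -> [disjoint B & F] ->
  \sum_(L : {set T} |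
      (L \subset F) && ((m \in L :|: B) && ((L :|: B) :\ m \subset D)))
     (-1) ^+ #|L|
    = if [&& m \in B :|: F, B :\ m \subset D & F :&: D == set0]
      then (-1) ^+ (m \in F) else 0 :> int.
Proof.
move=> mD dBF.
under eq_bigl => L do rewrite setDUl subUset.
case: (boolP (B :\ m \subset D)) => sBD; last first.
  by rewrite andbF big_pred0 // => L; rewrite !andbF.
have [mB | mB] := boolP (m \in B).
  have mF : m \notin F by rewrite (disjointFr dBF).
  rewrite inE mB (negPf mF) /= -signed_sum_subset.
  apply: eq_bigl => L; rewrite inE mB orbT andbT /= subsetI.
  have [sLF | //] := boolP (L \subset F).
  by rewrite setD1_id //; apply: contra mF; apply: subsetP.
have [mF | mF] := boolP (m \in F); last first.
  rewrite inE (negPf mB) (negPf mF) /= big_pred0 // => L.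
  rewrite inE (negPf mB) orbF; apply/negP => /and3P[sLF mL _].
  by case/negP: mF; apply: (subsetP sLF).
rewrite inE mF orbT /=.
(* Now [m] must come from [L], so the interval starts at [{m}]. *)
have /signed_sum_interval : [set m] \subset m |: (F :&: D) by rewrite subsetUl.
have -> : ([set m] == m |: (F :&: D)) = (F :&: D == set0).
  apply/eqP/eqP => [E | ->]; last by rewrite setU0.
  apply/setP => z; have := congr1 (fun X : {set T} => z \in X) E.
  rewrite !inE; case: (z =P m) => [-> _ | _ /= <- //].
  by rewrite (negPf mD) andbF.
rewrite cards1 => <-; apply: eq_bigl => L.
rewrite inE (negPf mB) orbF andbT sub1set andbCA; congr (_ && _).
rewrite -subDset subsetI; congr (_ && _); rewrite subDset.
by rewrite (setUidPr _) // sub1set.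
Qed.

End SignedSums.

(** Applied to [Max] or [Min], this splits a sum over the sets with one extremal
    element according to that element. *)
Lemma sum_card1 (I T : finType) (Q : pred I) (S : I -> {set T})
    (F : I -> int) :
  \sum_(i | Q i && (#|S i| == 1%N)) F i
    = \sum_(m : T) \sum_(i | Q i && (S i == [set m])) F i.
Proof.
rewrite (exchange_big_dep (fun i => Q i && (#|S i| == 1%N))) /=; last first.
  by move=> m i _ /andP[-> /eqP ->]; rewrite cards1.
apply: eq_bigr => i /andP[-> /cards1P[a ->]] /=.
by rewrite (big_pred1 a) // => m; rewrite (inj_eq set1_inj) eq_sym.
Qed.

(** * Greatest elements and the sums over one side of a cut *)

Section Extremal.
Context {d : Order.disp_t} {P : finPOrderType d}.
Implicit Types (x y z m : P) (S L R : {set P}).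
Local Open Scope order_scope.

Lemma parallelE x y : (y \in parallel x) = ~~ (y <= x) && ~~ (x <= y).
Proof. by rewrite inE /Order.comparable negb_or. Qed.

Lemma below_irrefl x : x \notin below x.
Proof. by rewrite inE ltxx. Qed.

(** Finiteness enters here: an element of [S] above [a] with the most elements
    below it is maximal. *)
Lemma exists_Max_ge S a : a \in S -> exists2 m, m \in Max S & a <= m.
Proof.
move=> aS; have Pa : (a \in S) && (a <= a) by rewrite aS lexx.
case: (@arg_maxnP _ a (fun m => (m \in S) && (a <= m))
         (fun m => #|below m|) Pa) => m /andP[mS am] mmax.
exists m => //; rewrite inE mS /=; apply/forall_inP => b bS.
apply/negP => mb.
have := mmax b; rewrite bS (le_trans am (ltW mb)) => /(_ isT).
rewrite /= leqNgt => /negP; apply; apply: proper_card; apply/properP; split.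
  by apply/subsetP => z; rewrite !inE => /lt_trans; apply.
by exists m; rewrite inE ?ltxx.
Qed.

Lemma Max_eq0 S : (Max S == set0) = (S == set0).
Proof.
apply/eqP/eqP => [E | ->]; last by apply/setP => z; rewrite !inE.
apply/setP => a; rewrite in_set0; apply/negP => /exists_Max_ge[m].
by rewrite E inE.
Qed.

(** The right-hand side says that [m] is the greatest element of [S]: every
    element is below a maximal one, and [m] is the only candidate. *)
Lemma Max_eq1 S m :
  (Max S == [set m]) = (m \in S) && (S :\ m \subset below m).
Proof.
apply/eqP/andP => [E | [mS /subsetP sub]].
  have mS : m \in S by have := set11 m; rewrite -E inE => /andP[].
  split=> //; apply/subsetP => z; rewrite !inE => /andP[zm].
  case/exists_Max_ge => m'; rewrite E inE => /eqP -> zm'.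
  by rewrite lt_neqAle zm.
apply/setP => z; rewrite !inE; apply/andP/eqP => [[zS /forall_inP zmax] | ->].
  apply/eqP; apply: contraT => zm; have := zmax m mS.
  by have := sub z; rewrite !inE zm zS => /(_ isT) ->.
split=> //; apply/forall_inP => b bS; apply/negP => mb.
have := sub b; rewrite !inE bS (gt_eqF mb) => /(_ isT) bm.
by have := lt_trans mb bm; rewrite ltxx.
Qed.

(** The rigidity condition on [m], namely that nothing parallel to [x] can be
    added below [m], says that [m] has the same strict down-set as [x]: an
    element below [m] cannot be above [x] when [m] is parallel to [x]. *)
Lemma eq_below_parallel x m : m \in parallel x ->
  (below m == below x)
    = (below x \subset below m) && (parallel x :&: below m == set0).
Proof.
rewrite parallelE => /andP[mx xm].
apply/eqP/andP => [E | [sub /eqP E]].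
  rewrite E subxx; split=> //; apply/eqP/setP => z.
  rewrite in_setI parallelE !inE; apply/negP => /andP[/andP[/negP zx _] /ltW].
  exact: zx.
apply/eqP; rewrite eqEsubset sub andbT; apply/subsetP => z zm.
have := congr1 (fun X : {set P} => z \in X) E.
rewrite in_setI zm parallelE andbT in_set0; move: zm; rewrite !inE => zm.
have -> : (x <= z) = false.
  by apply/negP => xz; case/negP: xm; rewrite (le_trans xz (ltW zm)).
rewrite andbT => /negbFE; rewrite le_eqVlt => /orP[/eqP zx |//].
by case/negP: xm; rewrite -zx ltW.
Qed.

(** The first term counts [L = set0], when [m] is the only lower cover of [x];
    the second counts [L = [set m]], when [m] is a lower twin of [x], so that no
    other element of [parallel x] lies below [m]. *)
Lemma signed_sum_Max x m :
  (\sum_(L : {set P} |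
      (L \subset parallel x) && (Max (L :|: below x) == [set m]))
     (-1) ^+ #|L|
   = (Max (below x) == [set m])%:R
       - ((m \in parallel x) && (below m == below x))%:R :> int)%R.
Proof.
under eq_bigl => L do rewrite Max_eq1.
rewrite signed_sum_apex ?below_irrefl //; last first.
  rewrite -setI_eq0; apply/eqP/setP => z; rewrite !inE /Order.comparable.
  by case: (boolP (z < x)) => // /ltW ->.
rewrite Max_eq1 in_setU; have [mx | mx] := boolP (m \in below x).
  have mpF : m \in parallel x = false.
    by move: mx; rewrite parallelE inE => /ltW ->.
  (* An element below [m] is below [x], so it cannot be parallel to [x]. *)
  rewrite mpF /= subr0 [X in _ && X](_ : _ = true) ?andbT; first by case: ifP.
  apply/eqP/setP => z; rewrite in_setI parallelE !inE.
  rewrite inE in mx; apply/negP => /andP[/andP[/negP zx _] zm].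
  by case: zx; rewrite (ltW (lt_trans zm mx)).
rewrite /= sub0r; have [mp | //] := boolP (m \in parallel x).
rewrite /= expr1 setD1_id //.
by rewrite (eq_below_parallel mp); case: ifP.
Qed.

Lemma lower_coversE y : lower_covers y = Max (below y).
Proof.
apply/setP => z; rewrite !inE /covers; congr (_ && _).
apply/forallP/forall_inP => [H b | H b].
  by rewrite inE => by'; have := H b; rewrite by' andbT.
by apply/negP => /andP[zb by']; have := H b; rewrite inE by' zb => /(_ isT).
Qed.

End Extremal.

(** * Duality *)

Section Dual.
Context {d : Order.disp_t} {P : finPOrderType d}.
Implicit Types (x y z m : P) (S L R : {set P}).
Local Open Scope order_scope.

(** In the dual poset [below] and [Max] are convertible to [above] and [Min];
    [parallel] is only provably unchanged, because its two comparisons are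
    swapped. *)
Lemma parallel_dual x : @parallel _ P^d x = parallel x :> {set P}.
Proof. by apply/setP => z; rewrite !inE /Order.comparable orbC. Qed.

Lemma Min_eq0 S : (Min S == set0) = (S == set0).
Proof. exact: (@Max_eq0 _ P^d). Qed.

Lemma Min_eq1 S m :
  (Min S == [set m]) = (m \in S) && (S :\ m \subset above m).
Proof. exact: (@Max_eq1 _ P^d). Qed.

Lemma signed_sum_Min x m :
  (\sum_(R : {set P} |
      (R \subset parallel x) && (Min (R :|: above x) == [set m]))
     (-1) ^+ #|R|
   = (Min (above x) == [set m])%:R
       - ((m \in parallel x) && (above m == above x))%:R :> int)%R.
Proof. by have := @signed_sum_Max _ P^d x m; rewrite parallel_dual. Qed.

Lemma upper_coversE x : upper_covers x = Min (above x).
Proof.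
apply/setP => z; rewrite !inE /covers; congr (_ && _).
apply/forallP/forall_inP => [H b | H b].
  by rewrite inE => xb; have := H b; rewrite xb.
by apply/negP => /andP[xb bz]; have := H b; rewrite inE xb bz => /(_ isT).
Qed.

End Dual.

(** * Order-theoretic translations *)

Section Translations.
Context {d : Order.disp_t} {P : finPOrderType d}.
Implicit Types (x y z m : P) (S L R : {set P}).
Local Open Scope order_scope.

Lemma lower_twin_parallel x m :
  lower_twin x m = (m \in parallel x) && (below m == below x).
Proof.
rewrite /lower_twin (eq_sym (below x)) parallelE.
case: (below m =P below x) => [Eb | _]; last by rewrite !andbF.
rewrite !andbT !le_eqVlt (eq_sym x m).
have -> : (m < x) = false.
  by have := below_irrefl m; rewrite Eb inE => /negPf.
have -> : (x < m) = false.
  by have := below_irrefl x; rewrite -Eb inE => /negPf.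
by rewrite !orbF andbb.
Qed.

Lemma twin_parallel x m :
  twin x m = [&& m \in parallel x, below m == below x & above m == above x].
Proof.
by rewrite (andbA (m \in _)) -lower_twin_parallel (eq_sym (above m)) -andbA.
Qed.

(** The right-hand side is the shape produced by the sums over cuts: the second
    conjunct collects the conditions under which the sum over [L] is nonzero.
    Once [m] is the least element above [x], the elements below [m] other than
    [x] are below [x] or parallel to it, so excluding the parallel ones makes
    [x] the greatest element below [m]. *)
Lemma series_pairE x m :
  series_pair x m = (Min (above x) == [set m])
                      && [&& below x \subset below m
                           & parallel x :&: below m == set0].
Proof.
rewrite /series_pair upper_coversE lower_coversE Min_eq1 Max_eq1 !inE.
have [xm | //] := boolP (x < m) => /=.
case: (boolP (above x :\ m \subset above m)) => //= /subsetP Hup.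
have -> : below x \subset below m.
  by apply/subsetP => z; rewrite !inE => /lt_trans; apply.
apply/subsetP/eqP => [H | E z].
  apply/setP => z; rewrite in_setI parallelE in_set0 inE; apply/negP.
  case/andP=> /andP[zx xz] zm; have := H z.
  rewrite !inE zm andbT; case: eqP => [zx'|_ /(_ isT) zx'].
    by case/negP: zx; rewrite zx'.
  by case/negP: zx; exact: ltW.
rewrite !inE => /andP[zx zm].
have := congr1 (fun X : {set P} => z \in X) E.
rewrite in_setI parallelE in_set0 inE zm andbT le_eqVlt (negPf zx) /=.
rewrite le_eqVlt eq_sym (negPf zx) /=.
have [xz | _] := boolP (x < z); last by rewrite andbT => /negbFE.
have := Hup z; rewrite !inE xz (lt_eqF zm) => /(_ isT) mz.
by have := lt_trans mz zm; rewrite ltxx.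
Qed.

Lemma isolatedE x : isolated x = (above x == set0) && (below x == set0).
Proof.
apply/forallP/andP => [H | [/eqP Ea /eqP Eb] y].
  split; apply/eqP/setP => z; rewrite !inE; apply/negP => zx;
    have := H z; rewrite ?(gt_eqF zx) ?(lt_eqF zx) /Order.comparable /=.
    by rewrite (ltW zx) orbT.
  by rewrite (ltW zx).
apply/implyP => yx; rewrite /Order.comparable !le_eqVlt (eq_sym x).
rewrite (negPf yx) /=.
have := in_set0 y; rewrite -{1}Ea inE => ->.
by have := in_set0 y; rewrite -{1}Eb inE => ->.
Qed.

Lemma greatestE x : greatest x = (above x == set0) && (parallel x == set0).
Proof.
apply/forallP/andP => [H | [/eqP Ea /eqP Ep] y].
  split; apply/eqP/setP => z; rewrite ?parallelE in_set0 ?inE; apply/negP.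
    move=> xz; have := H z; rewrite (gt_eqF xz) => /lt_trans/(_ xz).
    by rewrite ltxx.
  case/andP=> zx _; have := H z; case: eqP => [E | _ /= /ltW zx'].
    by rewrite E lexx in zx.
  by rewrite zx' in zx.
apply/implyP => yx.
have := in_set0 y; rewrite -{1}Ep parallelE.
have := in_set0 y; rewrite -{1}Ea inE [x <= y]le_eqVlt => ->.
by rewrite eq_sym (negPf yx) /= andbT le_eqVlt (negPf yx) => /negbFE.
Qed.

Lemma maximalE x : maximal x = (above x == set0).
Proof.
rewrite /maximal !inE /=; apply/forall_inP/eqP => [H | E b _].
  by apply/setP => z; rewrite !inE; apply/negbTE/H; rewrite inE.
by have := in_set0 b; rewrite -{1}E inE => ->.
Qed.

End Translations.

(** * Sums over cuts *)

Section Cuts.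
Context {d : Order.disp_t} {P : finPOrderType d}.
Implicit Types (x y z m : P) (S L R : {set P}).
Local Open Scope order_scope.

Lemma cut_least x m L R : Min (R :|: above x) = [set m] ->
  cut x L R = [&& L \subset parallel x, R \subset parallel x
                & L :|: below x \subset below m].
Proof.
move/eqP; rewrite Min_eq1 /cut => /andP[mR /subsetP Hm]; congr [&& _, _ & _].
apply/forall_inP/subsetP => [H a aL | H a aL].
  by have /forall_inP/(_ m mR) := H a aL; rewrite inE.
have := H a aL; rewrite inE => am; apply/forall_inP => b bR.
have [-> // | bm] := eqVneq b m.
by have := Hm b; rewrite inE in_set1 bm bR inE => /(_ isT); apply: lt_trans.
Qed.

Lemma set_lt0 L : set_lt L set0.
Proof. by apply/forall_inP => a _; apply/forall_inP => b; rewrite inE. Qed.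

Lemma signed_sum_cut_q0 x (Q : pred {set P}) :
  (\sum_(LR : {set P} * {set P} |
        [&& cut x LR.1 LR.2, cut_q x LR.2 == 0%N & Q LR.1])
     (-1) ^+ (#|LR.1| + #|LR.2|)
   = if above x == set0
     then \sum_(L : {set P} | (L \subset parallel x) && Q L) (-1) ^+ #|L|
     else 0 :> int)%R.
Proof.
have q0 R : (cut_q x R == 0%N) = (R == set0) && (above x == set0).
  by rewrite /cut_q cards_eq0 Min_eq0 setU_eq0.
case: eqP => [Ea | /eqP /negPf Ea]; last first.
  by rewrite big_pred0 // => LR; rewrite q0 Ea !andbF.
rewrite (eq_bigl (fun LR : {set P} * {set P} =>
   ((LR.1 \subset parallel x) && Q LR.1) && (LR.2 == set0))); last first.
  case=> L R /=; rewrite q0 Ea eqxx andbT.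
  case: (R =P set0) => [-> | _]; last by rewrite !andbF.
  by rewrite /cut Ea setU0 set_lt0 sub0set !andbT.
rewrite (signed_sum_pairs (fun L => (L \subset parallel x) && Q L)
           (pred1 set0)).
by rewrite big_pred1_eq cards0 mulr1.
Qed.

(** Given the least element [m], the conditions on [L] and [R] are independent,
    so the sum is a product. The factor for [L] is [1] if [m] is above all of
    [below x] and above nothing parallel to [x], and [0] otherwise; multiplying
    [signed_sum_Min] by it upgrades a unique upper cover to a series pair, and a
    set equality of up-sets to a twin. *)
Lemma signed_sum_cut_least x m :
  (\sum_(LR : {set P} * {set P} |
        cut x LR.1 LR.2 && (Min (LR.2 :|: above x) == [set m]))
     (-1) ^+ (#|LR.1| + #|LR.2|)
   = (series_pair x m)%:R - (twin x m)%:R :> int)%R.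
Proof.
rewrite (eq_bigl (fun LR : {set P} * {set P} =>
   ((LR.1 \subset parallel x) && (LR.1 :|: below x \subset below m)) &&
   ((LR.2 \subset parallel x) && (Min (LR.2 :|: above x) == [set m]))));
  last first.
  case=> L R /=; case: eqP => [E | _]; last by rewrite !andbF.
  by rewrite (cut_least L E) !andbT -andbA [X in _ && X]andbC.
rewrite (signed_sum_pairs
  (fun L => (L \subset parallel x) && (L :|: below x \subset below m))
  (fun R => (R \subset parallel x) && (Min (R :|: above x) == [set m]))).
rewrite signed_sum_Min.
under eq_bigl => L do rewrite subUset andbA -subsetI andbC.
rewrite series_pairE twin_parallel.
have [sub | nsub] /= := boolP (below x \subset below m); last first.
  rewrite big_pred0 // mul0r andbF.
  case: (below m =P below x) => [E | _]; last by rewrite andbF.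
  by rewrite E subxx in nsub.
rewrite signed_sum_subset.
have [mp | _] /= := boolP (m \in parallel x).
  rewrite (eq_below_parallel mp) sub /= andbC.
  by case: (_ == set0); rewrite ?mul1r ?mul0r ?andbF // andbT.
by case: (_ == set0); rewrite ?mul1r ?mul0r ?andbF // andbT.
Qed.

End Cuts.

(** * Coefficients of the polynomial *)

Section Coefficients.
Context {d : Order.disp_t} {P : finPOrderType d}.
Implicit Types (x y z m : P) (S L R : {set P}).
Local Open Scope order_scope.

Lemma lambda_coefq q x :
  ((lambda x)`_q
   = \sum_(LR : {set P} * {set P} | cut x LR.1 LR.2 && (cut_q x LR.2 == q))
       (-1) ^+ (#|LR.1| + #|LR.2|) * 'X ^+ cut_p x LR.1)%R.
Proof.
rewrite /lambda coef_sum [RHS]big_mkcondr; apply: eq_bigr => LR _.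
have -> : ((-1) ^+ (#|LR.1| + #|LR.2|) * 'X%:P ^+ cut_p x LR.1
           = ((-1) ^+ (#|LR.1| + #|LR.2|) * 'X ^+ cut_p x LR.1)%:P
           :> {poly {poly int}})%R.
  by rewrite polyCM !polyC_exp polyCN.
by rewrite coefCM coefXn eq_sym; case: ifP; rewrite ?mulr1 ?mulr0.
Qed.

Lemma lambda_coefE p q x :
  (lambda_coef p q x
   = \sum_(LR : {set P} * {set P} |
        [&& cut x LR.1 LR.2, cut_q x LR.2 == q & cut_p x LR.1 == p])
       (-1) ^+ (#|LR.1| + #|LR.2|))%R.
Proof.
rewrite /lambda_coef lambda_coefq coef_sum.
under [RHS]eq_bigl => LR do rewrite andbA.
rewrite [RHS]big_mkcondr; apply: eq_bigr => LR _.
rewrite -polyCN -polyC_exp coefCM coefXn eq_sym.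
by case: ifP; rewrite ?mulr1 ?mulr0.
Qed.

(** Summing the coefficients over all powers of [u] is evaluating at [u = 1]. *)
Lemma lambda_starE q x :
  (lambda_star q x
   = \sum_(LR : {set P} * {set P} | cut x LR.1 LR.2 && (cut_q x LR.2 == q))
       (-1) ^+ (#|LR.1| + #|LR.2|))%R.
Proof.
have -> : (lambda_star q x = ((lambda x)`_q).[1])%R.
  rewrite horner_coef /lambda_star big_mkord.
  by apply: eq_bigr => i _; rewrite expr1n mulr1.
rewrite lambda_coefq horner_sum; apply: eq_bigr => LR _.
by rewrite -polyCN -polyC_exp hornerCM hornerXn expr1n mulr1.
Qed.

(** The partner of [x] in a series pair is its unique upper cover, so at most
    one term is nonzero. *)
Lemma sum_series_pair x :
  (\sum_(m : P) (series_pair x m)%:R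
     = if begins_series_pair x then 1 else 0 :> int)%R.
Proof.
rewrite /begins_series_pair; case: existsP => [[y xy] | no]; last first.
  rewrite big1 // => m _; case: (boolP (series_pair x m)) => // xm.
  by case: no; exists m.
rewrite (bigD1 y) //= xy big1 ?addr0 // => m my.
move: xy; rewrite /series_pair => /and3P[_ /eqP -> _].
by rewrite (inj_eq set1_inj) eq_sym (negPf my) andbF.
Qed.

Lemma sum_indicator (Q : pred P) :
  (\sum_(m : P) (Q m)%:R = #|[set m | Q m]|%:Z :> int)%R.
Proof.
rewrite -sum1_card [in RHS]big_mkcond -natr_sum natz; congr Posz.
by apply: eq_bigr => m _; rewrite inE; case: (Q m).
Qed.

Lemma sum_eq_set1 S :
  (\sum_(m : P) (S == [set m])%:R = if #|S| == 1%N then 1 else 0 :> int)%R.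
Proof.
have := sum_card1 (I := unit) predT (fun=> S) (fun=> 1%R).
rewrite big_mkcond big_const card_unit /= addr0 => ->.
apply: eq_bigr => m _.
by rewrite big_mkcond big_const card_unit /= addr0; case: eqP.
Qed.

End Coefficients.

(** * The low coefficients *)

Theorem proposition4p9 (d : Order.disp_t) (P : finPOrderType d) (x : P) :
  [/\ lambda_coef 0 0 x = (if isolated x then 1 else 0),
      lambda_star 0 x = (if greatest x then 1 else 0),
      (~~ maximal x -> lambda_coef 1 0 x = 0) /\
      (maximal x ->
         lambda_coef 1 0 x =
           (if #|lower_covers x| == 1%N then 1 else 0)
             - (lower_twin_count x)%:Z)
    & lambda_star 1 x =
        (if begins_series_pair x then 1 else 0) - (tau x)%:Z].
Proof.
split.
- rewrite lambda_coefE (signed_sum_cut_q0 x (fun L => cut_p x L == 0%N)).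
  rewrite isolatedE.
  case: (above x == set0) => //=.
  under eq_bigl => L do rewrite /cut_p cards_eq0 Max_eq0 setU_eq0.
  case: (below x == set0); last by rewrite big_pred0 // => L; rewrite !andbF.
  rewrite (big_pred1 set0) ?cards0 // => L; rewrite andbT /=.
  by case: eqP => [-> | _]; rewrite ?sub0set ?andbF.
- rewrite lambda_starE greatestE.
  have := signed_sum_cut_q0 x predT.
  under eq_bigl => LR do rewrite andbT.
  move=> ->; case: (above x == set0) => //=.
  by under eq_bigl => L do rewrite andbT; rewrite signed_sum_subset.
- rewrite lambda_coefE (signed_sum_cut_q0 x (fun L => cut_p x L == 1%N)).
  rewrite maximalE.
  split=> [/negPf -> // | /eqP Ea]; rewrite Ea eqxx.
  rewrite sum_card1.
  under eq_bigr => m _ do rewrite signed_sum_Max.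
  rewrite big_split /= sumrN sum_eq_set1 -lower_coversE sum_indicator.
  congr (_ - (_ : nat)%:Z); apply: eq_card => m.
  by rewrite [RHS]in_set [LHS]in_set lower_twin_parallel.
- rewrite lambda_starE sum_card1.
  under eq_bigr => m _ do rewrite signed_sum_cut_least.
  by rewrite big_split /= sumrN sum_series_pair sum_indicator.
Qed.
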